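(* Let $S\in\mathcal M_d(\mathbb C)^+$, let $\mathbf a=(a_i)_{i\in\mathbb I_k}\in(\mathbb R^k_{>0})^\downarrow$ with $k\ge d$, and let $N$ be a strictly convex unitarily invariant norm on $\mathcal M_d(\mathbb C)$. Let $\mathcal G_0=\{g_i\}_{i\in\mathbb I_k}$ be a local minimizer of $\Theta:\mathbb T_d(\mathbf a)\to\mathbb R_{\ge0}$, $\Theta(\mathcal G)=N(S-S_{\mathcal G})$, in $\mathbb T_d(\mathbf a)$ such that there exists $c_1\in\mathbb R$ that satisfies $(S-S_{\mathcal G_0})g_i=c_1\,g_i$, for $i\in\mathbb I_k$. Then there exists an orthonormal basis $\{v_i\}_{i\in\mathbb I_d}$ of $\mathbb C^d$ such that $$S=\sum_{i\in\mathbb I_d}\lambda_i\ v_i\otimes v_i\quad\text{and}\quad S_{\mathcal G_0}=\sum_{i\in\mathbb I_d}(\lambda_i-c_1)^+\ v_i\otimes v_i,$$ where $(\lambda_i)_{i\in\mathbb I_d}=\lambda(S)\in(\mathbb R^d_{\ge0})^\downarrow$. Moreover, $\lambda(S-S_{\mathcal G_0})\prec\lambda(S-S_{\mathcal G})$ for every $\mathcal G\in\mathbb T_d(\mathbf a)$. In particular, $\mathcal G_0$ is a global minimizer of $\Theta$ in $\mathbb T_d(\mathbf a)$.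
   Context: $\mathbb I_n=\{1,\dots,n\}$. $\mathcal M_d(\mathbb C)$ is the algebra of complex $d\times d$ matrices and $\mathcal M_d(\mathbb C)^+$ the cone of positive semidefinite matrices. For $x\in\mathbb R^d$, $x^\downarrow$ is the non-increasing rearrangement of $x$; $(\mathbb R^k_{>0})^\downarrow$ and $(\mathbb R^d_{\ge0})^\downarrow$ denote vectors with positive, respectively nonnegative, entries in non-increasing order. For $x\in\mathbb R$, $x^+=\max\{x,0\}$. For selfadjoint $A$, $\lambda(A)$ is the vector of eigenvalues counting multiplicities in non-increasing order. For $x,y\in\mathbb C^d$, $(x\otimes y)z=\langle z,y\rangle x$. For $x,y\in\mathbb R^d$, $x\prec y$ ($x$ is majorized by $y$) means $\sum_{i=1}^jx_i^\downarrow\le\sum_{i=1}^jy_i^\downarrow$ for $1\le j\le d$, with equality for $j=d$. A norm $N$ is unitarily invariant if $N(UAV)=N(A)$ for all $A\in\mathcal M_d(\mathbb C)$ and all unitary $U,V$. $\mathbb T_d(\mathbf a)=\{\mathcal G=\{g_i\}_{i\in\mathbb I_k}\in(\mathbb C^d)^k:\|g_i\|^2=a_i\text{ for every }i\in\mathbb I_k\}$, with the metric $d(\mathcal G,\mathcal G')=\max\{\|g_i-g_i'\|:i\in\mathbb I_k\}$. The frame operator of $\mathcal G=\{g_i\}_{i\in\mathbb I_k}$ is $S_{\mathcal G}=\sum_{i\in\mathbb I_k}g_i\otimes g_i$. *)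

(* Defs.v *)
From HB Require Import structures.
From mathcomp Require Import all_boot all_order all_algebra.
From mathcomp Require Import complex.
From mathcomp Require Import reals.

Set Implicit Arguments.
Unset Strict Implicit.
Unset Printing Implicit Defensive.

Import Order.TTheory GRing.Theory Num.Theory.
Local Open Scope ring_scope.
Local Open Scope complex_scope.
Local Open Scope sesquilinear_scope.

Section Vectors.
Variables (R : realType) (d : nat).
Implicit Types (x y z : 'cV[R[i]]_d) (A B U V : 'M[R[i]]_d).

Definition inner x y : R[i] := \sum_(i < d) x i 0 * ((y i 0)^*)%R.

Definition vnorm x : R := Num.sqrt (\sum_(i < d) Normc.normc (x i 0) ^+ 2).

(* The rank-one operator z |-> <z, y> x; see [tensorE]. *)
Definition tensor x y : 'M[R[i]]_d := x *m y^t*.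

Definition orthonormal_basis (v : 'I_d -> 'cV[R[i]]_d) : Prop :=
  (forall i j : 'I_d, inner (v i) (v j) = (i == j)%:R) /\
  basis_of {: 'cV[R[i]]_d} (codom v).

(* In R[i], 0 <= z says that z is real and nonnegative, so this definition
   forces A to be selfadjoint. *)
Definition psd A : Prop := forall x, 0 <= inner (A *m x) x.

End Vectors.

Section RealVectors.
Variables (R : realType) (d : nat).
Implicit Types x y : 'rV[R]_d.

Definition nonincreasing x : Prop :=
  forall i j : 'I_d, (i <= j)%N -> x 0 j <= x 0 i.

Definition rearr x : 'rV[R]_d :=
  \row_(i < d) (sort >=%R [seq x 0 j | j : 'I_d])`_i.

Definition majorized x y : Prop :=
  (forall j : nat, (1 <= j <= d)%N ->
     \sum_(i < d | (i < j)%N) rearr x 0 i <=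
     \sum_(i < d | (i < j)%N) rearr y 0 i) /\
  \sum_(i < d) rearr x 0 i = \sum_(i < d) rearr y 0 i.

(* Only meaningful for selfadjoint A, whose spectral_diag is real;
   see [char_poly_eigvals]. *)
Definition eigvals (A : 'M[R[i]]_d) : 'rV[R]_d :=
  rearr (map_mx (@complex.Re R) (spectral_diag A)).

End RealVectors.

Section Norms.
Variables (R : realType) (d : nat).
Implicit Types (A B U V : 'M[R[i]]_d) (N : 'M[R[i]]_d -> R).

Definition is_norm N : Prop :=
  [/\ forall A, 0 <= N A,
      forall A, N A = 0 -> A = 0,
      forall (z : R[i]) A, N (z *: A) = Normc.normc z * N A &
      forall A B, N (A + B) <= N A + N B].

Definition unitarily_invariant N : Prop :=
  forall A U V, U \is unitarymx -> V \is unitarymx -> N (U *m A *m V) = N A.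

(* The unit sphere of N contains no nontrivial segment. *)
Definition strictly_convex N : Prop :=
  forall A B (t : R), N A = 1 -> N B = 1 -> A != B -> 0 < t < 1 ->
    N (t%:C *: A + (1 - t)%:C *: B) < 1.

End Norms.

Section Frames.
Variables (R : realType) (d k : nat).
Implicit Types (a : 'rV[R]_k) (G : 'I_k -> 'cV[R[i]]_d).

Definition torus a G : Prop := forall i, vnorm (G i) ^+ 2 = a 0 i.

Definition fam_dist G G' : R := \big[Num.max/0]_(i < k) vnorm (G i - G' i).

Definition frame_op G : 'M[R[i]]_d := \sum_(i < k) tensor (G i) (G i).

Definition Theta (N : 'M[R[i]]_d -> R) (S : 'M[R[i]]_d) G : R :=
  N (S - frame_op G).

Definition local_minimizer (F : ('I_k -> 'cV[R[i]]_d) -> R) a G0 : Prop :=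
  torus a G0 /\
  exists2 e : R, 0 < e &
    forall G, torus a G -> fam_dist G0 G < e -> F G0 <= F G.

Definition global_minimizer (F : ('I_k -> 'cV[R[i]]_d) -> R) a G0 : Prop :=
  torus a G0 /\ forall G, torus a G -> F G0 <= F G.

End Frames.

Lemma tensorE (R : realType) d (x y z : 'cV[R[i]]_d) :
  tensor x y *m z = inner z y *: x.
Proof.
apply/matrixP => i j; rewrite (ord1 j) -mulmxA !mxE big_ord1 mulrC !mxE.
congr (_ * _); apply: eq_bigr => l _.
by rewrite !mxE mulrC.
Qed.

Lemma rearr_nonincreasing (R : realType) d (x : 'rV[R]_d) :
  nonincreasing (rearr x).
Proof.
move=> i j le_ij; rewrite !mxE.
have ge_tr : transitive (>=%R : rel R).
  by move=> u v w /= vu wv; exact: le_trans wv vu.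
have ge_re : reflexive (>=%R : rel R) by move=> u /=; exact: lexx.
have ge_to : total (>=%R : rel R) by move=> u v /=; exact: le_total.
apply: (sorted_leq_nth ge_tr ge_re 0 (sort_sorted ge_to _)) => //.
- by rewrite inE size_sort size_map size_enum_ord.
- by rewrite inE size_sort size_map size_enum_ord.
Qed.

Lemma prod_rearr (R : realType) (T : comNzRingType) d (x : 'rV[R]_d)
    (f : R -> T) :
  \prod_(i < d) f (rearr x 0 i) = \prod_(i < d) f (x 0 i).
Proof.
have sz : size (sort >=%R [seq x 0 j | j : 'I_d]) = d.
  by rewrite size_sort size_map size_enum_ord.
transitivity (\prod_(t <- sort >=%R [seq x 0 j | j : 'I_d]) f t).
  rewrite (big_nth 0) sz big_mkord.
  by apply: eq_bigr => i _; rewrite mxE.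
rewrite (perm_big [seq x 0 j | j : 'I_d]) ?perm_sort //=.
by rewrite big_map big_enum.
Qed.

Lemma char_poly_eigvals (R : realType) d (A : 'M[R[i]]_d) :
  A = A^t* -> char_poly A = \prod_(i < d) ('X - ((eigvals A 0 i)%:C)%:P).
Proof.
move=> hA.
have hermA : A \is hermsymmx.
  by apply/is_hermitianmxP; rewrite expr0 scale1r.
have /orthomx_spectralP eA := hermitian_normalmx hermA.
have uP := spectral_unit A.
have charE : char_poly A = char_poly (diag_mx (spectral_diag A)).
  rewrite {1}eA /char_poly /char_poly_mx.
  set P := spectralmx A; set D := diag_mx _.
  have uP' : map_mx (@polyC R[i]) P \in unitmx by rewrite map_unitmx.
  rewrite !map_mxM map_invmx.
  have eX : 'X%:M =
      invmx (map_mx (@polyC R[i]) P) *m 'X%:M *m map_mx (@polyC R[i]) P.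
    by rewrite -mulmxA -scalar_mxC mulmxA mulVmx // mul1mx.
  rewrite [in LHS]eX.
  rewrite -mulmxBl -mulmxBr !det_mulmx mulrAC -det_mulmx (mulVmx uP').
  by rewrite det1 mul1r.
rewrite charE char_poly_trig ?diag_mx_is_trig //.
rewrite (prod_rearr _ (fun t => 'X - (t%:C)%:P)).
apply: eq_bigr => i _; rewrite !mxE eqxx mulr1n.
have /mxOverP/(_ 0 i) := hermitian_spectral_diag_real hermA.
by move/RRe_real => ->.
Qed.

(* Main.v *)
Require Import Defs.
From mathcomp Require Import all_boot all_order all_algebra perm.
From mathcomp Require Import complex.
From mathcomp Require Import reals.
From mathcomp Require Import ring lra.
Import Order.TTheory GRing.Theory Num.Theory.
Local Open Scope ring_scope.
Local Open Scope complex_scope.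
Local Open Scope sesquilinear_scope.

Set Implicit Arguments.
Unset Strict Implicit.
Unset Printing Implicit Defensive.

(** Write F for the frame operator of G0 and D = S - F. The hypothesis that
    each g_i is an eigenvector of D for c1 gives D F = c1 F, so F commutes with
    S, and F acts as l - c1 on the part of each eigenspace of S (for l) that
    lies in the range of F.

    The point is that the kernel of F contains no eigenvector q of S for any
    l > c1. Suppose it does. Then the g_i are orthogonal to q, and as there
    are at least d of them they are linearly dependent. Rotate each g_i slightly
    towards q, with the cross terms c_i s_i^* proportional to the coefficients
    of a linear relation ([rotation_coefficients]). The cross terms then cancel
    exactly, and D changes by transfers of spectrum from q, where D is l, to
    the normalized g_i, where D is c1 ([rotated_tensor]). Such a transfer is a
    strict convex combination of D and its conjugate by the reflection that
    exchanges the two eigenvectors, so it lowers the norm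
    ([norm_transfer_lt]), contradicting local minimality ([local_descent]).
    Hence F acts as (l - c1)^+ on every eigenvector of S ([frame_op_eigen]),
    and any sorted eigenbasis of S is the required one.

    So D has the eigenvalues min(lambda_i, c1): the water-filling residual of
    lambda(S). For another family G in the torus, the diagonal of
    S - frame_op G in the eigenbasis of S is at most lambda(S), since
    frame_op G is positive, and its sum is the same as for G0. Ky Fan's
    principle ([ky_fan]) bounds its partial sums by those of the eigenvalues of
    S - frame_op G, and [water_filling] turns this into the majorization.
    Finally a unitarily invariant norm is a symmetric convex function of the
    eigenvalues of a selfadjoint matrix, hence monotone for majorization
    ([majorized_convex_le]), which gives global minimality. *)

Local Notation normc := (@Normc.normc _).

(** * Adjoints, the inner product and rank-one operators *)

Section Adjoint.
Variable (R : realType).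
Local Notation C := R[i].

Lemma adjM m n p (A : 'M[C]_(m, n)) (B : 'M[C]_(n, p)) :
  (A *m B)^t* = B^t* *m A^t*.
Proof. by rewrite trmx_mul map_mxM. Qed.

Lemma adjB m n (A B : 'M[C]_(m, n)) : (A - B)^t* = A^t* - B^t*.
Proof. by rewrite linearB map_mxB. Qed.

Lemma adjD m n (A B : 'M[C]_(m, n)) : (A + B)^t* = A^t* + B^t*.
Proof. by rewrite linearD map_mxD. Qed.

Lemma adjZ m n c (A : 'M[C]_(m, n)) : (c *: A)^t* = (c^*)%R *: A^t*.
Proof. by rewrite linearZ map_mxZ. Qed.

Lemma conj_real (x : R) : ((x%:C)^*)%R = x%:C.
Proof. by apply/CrealP/complex_realP; exists x. Qed.

Variable d : nat.
Implicit Types (x y z w : 'cV[C]_d) (A B : 'M[C]_d).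

Lemma innerE x y : y^t* *m x = (inner x y)%:M.
Proof.
apply/matrixP => i j; rewrite !ord1 !mxE mulr1n.
by apply: eq_bigr => l _; rewrite !mxE mulrC.
Qed.

Lemma inner_conj x y : inner y x = ((inner x y)^*)%R.
Proof.
rewrite /inner rmorph_sum; apply: eq_bigr => l _.
by rewrite rmorphM /= conjCK mulrC.
Qed.

Lemma inner_conjC x y : ((inner x y)^*)%R = inner y x.
Proof. by rewrite -inner_conj. Qed.

Lemma innerDl x y z : inner (x + y) z = inner x z + inner y z.
Proof. by rewrite -big_split; apply: eq_bigr => l _; rewrite mxE mulrDl. Qed.

Lemma innerZl c x y : inner (c *: x) y = c * inner x y.
Proof. by rewrite mulr_sumr; apply: eq_bigr => l _; rewrite mxE mulrA. Qed.

Lemma innerNl x y : inner (- x) y = - inner x y.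
Proof. by rewrite -scaleN1r innerZl mulN1r. Qed.

Lemma innerBl x y z : inner (x - y) z = inner x z - inner y z.
Proof. by rewrite innerDl innerNl. Qed.

Lemma inner0l y : inner 0 y = 0.
Proof. by rewrite -(scale0r 0) innerZl mul0r. Qed.

Lemma innerDr x y z : inner x (y + z) = inner x y + inner x z.
Proof. by rewrite inner_conj innerDl rmorphD /= !inner_conjC. Qed.

Lemma innerZr c x y : inner x (c *: y) = (c^*)%R * inner x y.
Proof. by rewrite inner_conj innerZl rmorphM /= inner_conjC. Qed.

Lemma innerBr x y z : inner x (y - z) = inner x y - inner x z.
Proof. by rewrite inner_conj innerBl rmorphB /= !inner_conjC. Qed.

Lemma inner_suml (I : Type) (r : seq I) (P : pred I) (F : I -> 'cV[C]_d) y :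
  inner (\sum_(i <- r | P i) F i) y = \sum_(i <- r | P i) inner (F i) y.
Proof.
apply: (big_morph (fun x => inner x y)) => [u v|]; [exact: innerDl|].
exact: inner0l.
Qed.

Lemma inner_adj A x y : inner (A *m x) y = inner x (A^t* *m y).
Proof.
have e : (inner (A *m x) y)%:M = (inner x (A^t* *m y))%:M :> 'M[C]_1.
  by rewrite -!innerE adjM trmxCK mulmxA.
by move/matrixP/(_ 0 0): e; rewrite !mxE !mulr1n.
Qed.

Lemma inner_ge0 x : 0 <= inner x x.
Proof. by apply: sumr_ge0 => l _; rewrite mul_conjC_ge0. Qed.

Lemma inner_eq0 x : (inner x x == 0) = (x == 0).
Proof.
apply/idP/eqP => [|->]; last by rewrite inner0l.
rewrite psumr_eq0 => [|l _]; last by rewrite mul_conjC_ge0.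
move/allP => h; apply/matrixP => i j; rewrite !ord1 mxE.
have := h i; rewrite mem_index_enum => /(_ isT) /=.
by rewrite mul_conjC_eq0 => /eqP.
Qed.

Lemma vnorm_sqr x : (vnorm x ^+ 2)%:C = inner x x.
Proof.
rewrite /vnorm sqr_sqrtr; last by apply: sumr_ge0 => l _; rewrite sqr_ge0.
rewrite rmorph_sum; apply: eq_bigr => l _.
by rewrite rmorphXn /= -normCK.
Qed.

Lemma vnorm_ge0 x : 0 <= vnorm x.
Proof. exact: sqrtr_ge0. Qed.

Lemma tensor_mul x y z w : tensor x y *m tensor z w = inner z y *: tensor x w.
Proof. by rewrite mulmxA tensorE -scalemxAl. Qed.

Lemma mul_tensor A x y : A *m tensor x y = tensor (A *m x) y.
Proof. by rewrite mulmxA. Qed.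

Lemma tensor_mulr A x y : tensor x y *m A = tensor x (A^t* *m y).
Proof. by rewrite /tensor adjM trmxCK mulmxA. Qed.

Lemma tensor_adj x y : (tensor x y)^t* = tensor y x.
Proof. by rewrite /tensor adjM trmxCK. Qed.

Lemma tensorDl x y z : tensor (x + y) z = tensor x z + tensor y z.
Proof. exact: mulmxDl. Qed.

Lemma tensorDr x y z : tensor x (y + z) = tensor x y + tensor x z.
Proof. by rewrite /tensor adjD mulmxDr. Qed.

Lemma tensorBl x y z : tensor (x - y) z = tensor x z - tensor y z.
Proof. exact: mulmxBl. Qed.

Lemma tensorBr x y z : tensor x (y - z) = tensor x y - tensor x z.
Proof. by rewrite /tensor adjB mulmxBr. Qed.

Lemma tensorZl c x y : tensor (c *: x) y = c *: tensor x y.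
Proof. by rewrite /tensor scalemxAl. Qed.

Lemma tensorZr c x y : tensor x (c *: y) = (c^*)%R *: tensor x y.
Proof. by rewrite /tensor adjZ scalemxAr. Qed.

Lemma adj_sum (I : Type) (r : seq I) (P : pred I) (F : I -> 'M[C]_d) :
  (\sum_(i <- r | P i) F i)^t* = \sum_(i <- r | P i) (F i)^t*.
Proof. by rewrite linear_sum raddf_sum. Qed.

Lemma frame_op_adj k (G : 'I_k -> 'cV[C]_d) : (frame_op G)^t* = frame_op G.
Proof. by rewrite adj_sum; apply: eq_bigr => i _; rewrite tensor_adj. Qed.

(** The quadratic form of a frame operator collects the squared frame
    coefficients; this gives its positivity, its trace and its kernel. *)
Lemma frame_op_psd k (G : 'I_k -> 'cV[C]_d) x :
  inner (frame_op G *m x) x = \sum_i `|inner x (G i)| ^+ 2.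
Proof.
rewrite mulmx_suml inner_suml; apply: eq_bigr => i _.
by rewrite tensorE innerZl normCK inner_conjC.
Qed.

(** Over the complex numbers polarization recovers the whole sesquilinear
    form from its diagonal, by comparing x + y with 'i x + y. *)
Lemma quadratic_form_eq0 B : (forall x, inner (B *m x) x = 0) -> B = 0.
Proof.
move=> h.
have pol x y (t : C) : t * inner (B *m x) y + (t^*)%R * inner (B *m y) x = 0.
  have := h (t *: x + y); rewrite mulmxDr -scalemxAr !innerDl !innerDr.
  by rewrite !innerZl !innerZr !h !mulr0 add0r addr0.
have e0 x y : inner (B *m x) y = 0.
  have h1 := pol x y 1; have h2 := pol x y 'i%R.
  have iN0 : ('i : C)%R != 0 := neq0Ci _.
  move: h1 h2; rewrite rmorph1 !mul1r conjCi mulNr -mulrBr => h1 /eqP.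
  rewrite mulf_eq0 (negbTE iN0) subr_eq0 => /eqP h2; move: h1.
  by rewrite -h2 => /eqP; rewrite -mulr2n mulrn_eq0 => /eqP.
apply/matrixP => i j.
have /matrixP/(_ i 0) : col j B = 0.
  by apply/eqP; rewrite -inner_eq0 colE e0.
by rewrite !mxE.
Qed.

Lemma psd_adj A : psd A -> A^t* = A.
Proof.
move=> hA; apply/eqP; rewrite -subr_eq0; apply/eqP.
apply: quadratic_form_eq0 => x.
rewrite mulmxBl innerBl inner_adj trmxCK inner_conj.
by rewrite (CrealP (ger0_real (hA x))) subrr.
Qed.

End Adjoint.

(** * Sorted vectors and doubly stochastic averages *)

Section RealVec.
Variables (R : realType) (d : nat).
Implicit Types x y mu : 'rV[R]_d.

Lemma rearr_perm x : exists s : {perm 'I_d}, forall i, rearr x 0 i = x 0 (s i).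
Proof.
have : perm_eq (sort >=%R [tuple x 0 j | j < d]) [tuple x 0 j | j < d].
  by rewrite perm_sort.
case/tuple_permP => s es; exists s => i; rewrite mxE.
transitivity ((sort >=%R [tuple x 0 j | j < d])`_i); first by [].
by rewrite es -tnth_nth !tnth_mktuple.
Qed.

Lemma rearr_id x : nonincreasing x -> rearr x = x.
Proof.
move=> hx; apply/rowP => i; rewrite mxE.
have ge_tr : transitive (>=%R : rel R).
  by move=> u v w /= vu wv; exact: le_trans wv vu.
have sz : size [seq x 0 j | j : 'I_d] = d by rewrite size_map size_enum_ord.
have nthE (j : 'I_d) : [seq x 0 j | j : 'I_d]`_j = x 0 j.
  by rewrite (nth_map j) ?size_enum_ord // nth_ord_enum.
rewrite sorted_sort ?nthE //; apply/(sortedP 0) => j; rewrite sz => hj.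
by rewrite (nthE (Ordinal hj)) (nthE (Ordinal (ltnW hj))); apply: hx => /=.
Qed.

Lemma sum_ltnS (f : 'I_d -> R) (i : 'I_d) :
  \sum_(l < d | (l < i.+1)%N) f l = \sum_(l < d | (l < i)%N) f l + f i.
Proof.
rewrite (bigD1 i) ?ltnSn //= addrC; congr (_ + _).
by apply: eq_bigl => l; rewrite ltnS ltn_neqAle andbC.
Qed.

(** A level c separating the j largest entries from the others lets a sum over
    the first j indices be compared term by term with any other weighting of
    the same total mass. *)
Lemma nonincreasing_cut mu (j : nat) : nonincreasing mu ->
  exists c, forall l : 'I_d, if (l < j)%N then c <= mu 0 l else mu 0 l <= c.
Proof.
move=> hmu; have [hj|hj] := ltnP j d.
  exists (mu 0 (Ordinal hj)) => l; case: ltnP => hl; apply: hmu => //.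
  exact: ltnW.
case: (posnP d) => [d0|d0].
  by exists 0 => l; have := ltn_ord l; rewrite {2}d0.
have hd : (d.-1 < d)%N by rewrite prednK.
exists (mu 0 (Ordinal hd)) => l.
rewrite (leq_trans (ltn_ord l) hj); apply: hmu => /=.
by rewrite -ltnS prednK.
Qed.

(** Averaging cannot beat sorting. The weight that the first j rows of P put
    on column l lies in [0, 1], and the total weight is the number of those
    rows; subtracting a cut level c from mu makes the loss of moving weight
    away from the first j columns visibly nonnegative, column by column. *)
Lemma doubly_stochastic_partial_sum (P : 'I_d -> 'I_d -> R) mu j :
  (forall i l, 0 <= P i l) -> (forall i, \sum_l P i l = 1) ->
  (forall l, \sum_i P i l = 1) -> nonincreasing mu ->
  \sum_(i < d | (i < j)%N) \sum_l mu 0 l * P i l <=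
  \sum_(l < d | (l < j)%N) mu 0 l.
Proof.
move=> P0 Pr Pc hmu; have [c hc] := nonincreasing_cut j hmu.
pose q l := \sum_(i < d | (i < j)%N) P i l.
have q0 l : 0 <= q l by apply: sumr_ge0 => i _.
have q1 l : q l <= 1.
  rewrite -(Pc l) (bigID (fun i : 'I_d => (i < j)%N)) /= lerDl.
  by apply: sumr_ge0 => i _.
have sq : \sum_(l < d) ((l < j)%N%:R - q l) = 0.
  rewrite sumrB exchange_big /= [X in _ - X](eq_bigr (fun=> 1)) => [|i _].
    rewrite [X in _ - X]big_mkcond -sumrB big1 // => l _.
    by case: ifP; rewrite subrr.
  exact: Pr.
rewrite exchange_big /= -subr_ge0.
have -> : \sum_(l < d | (l < j)%N) mu 0 l -
    \sum_l \sum_(i < d | (i < j)%N) mu 0 l * P i l =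
  \sum_(l < d) (mu 0 l - c) * ((l < j)%N%:R - q l).
  under [RHS]eq_bigr => l _ do rewrite mulrBl.
  rewrite sumrB -mulr_sumr sq mulr0 subr0 big_mkcond -sumrB.
  apply: eq_bigr => l _; rewrite -mulr_sumr mulrBr.
  by case: ifP; rewrite ?mulr1 ?mulr0.
apply: sumr_ge0 => l _; have := hc l; case: ifP => _ h.
  by rewrite mulr_ge0 ?subr_ge0.
by rewrite mulr_le0 ?subr_le0.
Qed.

End RealVec.

(** * Spectral decompositions with sorted eigenvalues *)

Section Spectral.
Variables (R : realType) (d : nat).
Local Notation C := R[i].
Implicit Types (v w : 'I_d -> 'cV[C]_d) (x y mu : 'rV[R]_d) (A : 'M[C]_d).

Definition orthonormal v : Prop :=
  forall i j : 'I_d, inner (v i) (v j) = (i == j)%:R.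

Definition colmx v : 'M[C]_d := \matrix_(i, j) v j i 0.

(** A spectral decomposition is indexed by a family of vectors rather than by a
    unitary matrix, so that permuting eigenvalues is reindexing the family. *)
Definition spec v x : 'M[C]_d :=
  \sum_(i < d) (x 0 i)%:C *: tensor (v i) (v i).

Lemma colmx_adjK v : orthonormal v -> (colmx v)^t* *m colmx v = 1%:M.
Proof.
move=> hv; apply/matrixP => i j; rewrite !mxE eq_sym -hv.
by apply: eq_bigr => l _; rewrite !mxE mulrC.
Qed.

Lemma colmxK v : orthonormal v -> colmx v *m (colmx v)^t* = 1%:M.
Proof. by move/colmx_adjK/mulmx1C. Qed.

Lemma orthonormal_resolution v : orthonormal v ->
  \sum_i tensor (v i) (v i) = 1%:M.
Proof.
move=> hv; rewrite -(colmxK hv); apply/matrixP => i j.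
rewrite summxE !mxE; apply: eq_bigr => l _.
by rewrite !mxE big_ord1 !mxE.
Qed.

Lemma orthonormal_is_basis v : orthonormal v -> orthonormal_basis v.
Proof.
move=> hv; split=> //; rewrite basisEfree subvf size_codom card_ord.
rewrite dimvf /dim /= muln1 leqnn /= !andbT.
have sz : size (codom v) == d by rewrite size_codom card_ord.
have nthE (i : 'I_d) : (codom v)`_i = v i.
  by rewrite (nth_map i) ?size_enum_ord // nth_ord_enum.
rewrite -[codom v]/(tval (Tuple sz)); apply/freeP => c h i.
have : inner (\sum_(i < d) c i *: (codom v)`_i) (v i) = 0.
  by rewrite h inner0l.
rewrite inner_suml (bigD1 i) //= nthE innerZl hv eqxx mulr1.
rewrite big1 ?addr0 // => l nl.
by rewrite nthE innerZl hv (negbTE nl) mulr0.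
Qed.

Lemma parseval v z : orthonormal v ->
  inner z z = (\sum_i normc (inner z (v i)) ^+ 2)%:C.
Proof.
move=> hv; rewrite -{1}(mul1mx z) -(orthonormal_resolution hv).
rewrite mulmx_suml inner_suml rmorph_sum; apply: eq_bigr => i _.
by rewrite tensorE innerZl rmorphXn /= [RHS]normCK inner_conjC.
Qed.

Lemma spec_eigen v x i : orthonormal v -> spec v x *m v i = (x 0 i)%:C *: v i.
Proof.
move=> hv; rewrite mulmx_suml (bigD1 i) //= -scalemxAl tensorE hv eqxx scale1r.
by rewrite big1 ?addr0 // => l nl; rewrite -scalemxAl tensorE hv eq_sym
  (negbTE nl) scale0r scaler0.
Qed.

Lemma spec_of_eigenvectors v x A : orthonormal v ->
  (forall i, A *m v i = (x 0 i)%:C *: v i) -> A = spec v x.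
Proof.
move=> hv hA; rewrite -[A]mulmx1 -(orthonormal_resolution hv) mulmx_sumr.
by apply: eq_bigr => i _; rewrite mul_tensor hA tensorZl.
Qed.

Lemma spec_adj v x : (spec v x)^t* = spec v x.
Proof.
rewrite adj_sum; apply: eq_bigr => i _.
by rewrite adjZ conj_real tensor_adj.
Qed.

Lemma spec_form w mu z : inner (spec w mu *m z) z =
  (\sum_l mu 0 l * normc (inner z (w l)) ^+ 2)%:C.
Proof.
rewrite mulmx_suml inner_suml rmorph_sum; apply: eq_bigr => l _.
rewrite -scalemxAl tensorE !innerZl rmorphM rmorphXn /=; congr (_ * _).
by rewrite [RHS]normCK inner_conjC.
Qed.

(** The squared overlaps of two orthonormal bases form a doubly stochastic
    matrix, by Parseval's identity in either basis; this is what links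
    eigenvalues and diagonal entries. *)
Lemma overlap_row v w i : orthonormal v -> orthonormal w ->
  \sum_l normc (inner (v i) (w l)) ^+ 2 = 1.
Proof.
by move=> hv hw; apply: complexI; rewrite -parseval // hv eqxx.
Qed.

Lemma normc_innerC (y z : 'cV[C]_d) :
  normc (inner y z) = normc (inner z y).
Proof.
apply: complexI; change (`|inner y z| = `|inner z y|).
by rewrite inner_conj norm_conjC.
Qed.

Lemma overlap_col v w l : orthonormal v -> orthonormal w ->
  \sum_i normc (inner (v i) (w l)) ^+ 2 = 1.
Proof.
move=> hv hw; rewrite -(overlap_row l hw hv); apply: eq_bigr => i _.
by rewrite normc_innerC.
Qed.

(** Ky Fan's maximum principle: in another orthonormal basis the diagonal
    entries are averages of the eigenvalues by a doubly stochastic matrix. *)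
Lemma ky_fan v w mu j : orthonormal v -> orthonormal w -> nonincreasing mu ->
  \sum_(i < d | (i < j)%N) inner (spec w mu *m v i) (v i) <=
  (\sum_(i < d | (i < j)%N) mu 0 i)%:C.
Proof.
move=> hv hw hmu; under eq_bigr => i _ do rewrite spec_form.
rewrite -rmorph_sum lecR; apply: doubly_stochastic_partial_sum => //.
- by move=> i l; exact: sqr_ge0.
- by move=> i; exact: overlap_row.
- by move=> l; exact: overlap_col.
Qed.

Lemma trace_form v w mu : orthonormal v -> orthonormal w ->
  \sum_i inner (spec w mu *m v i) (v i) = (\sum_i mu 0 i)%:C.
Proof.
move=> hv hw; under eq_bigr => i _ do rewrite spec_form.
rewrite -rmorph_sum exchange_big /=; congr _%:C.
by apply: eq_bigr => l _; rewrite -mulr_sumr overlap_col ?mulr1.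
Qed.

Lemma spec_diag_sum v x (P : pred 'I_d) : orthonormal v ->
  \sum_(i < d | P i) inner (spec v x *m v i) (v i) =
  (\sum_(i < d | P i) x 0 i)%:C.
Proof.
move=> hv; rewrite rmorph_sum; apply: eq_bigr => i _.
by rewrite spec_eigen // innerZl hv eqxx mulr1.
Qed.

Lemma spec_partial_sum_le v w x mu j :
  orthonormal v -> orthonormal w -> nonincreasing mu -> spec v x = spec w mu ->
  \sum_(i < d | (i < j)%N) x 0 i <= \sum_(i < d | (i < j)%N) mu 0 i.
Proof.
move=> hv hw hmu e; rewrite -lecR -(spec_diag_sum _ _ hv) e.
exact: ky_fan.
Qed.

(** Sorted eigenvalues are unique: Ky Fan's principle, used in both directions,
    forces all partial sums to agree. *)
Lemma spec_inj v w x mu : orthonormal v -> orthonormal w ->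
  nonincreasing x -> nonincreasing mu -> spec v x = spec w mu -> x = mu.
Proof.
move=> hv hw hx hmu e.
have eqs j : \sum_(i < d | (i < j)%N) x 0 i = \sum_(i < d | (i < j)%N) mu 0 i.
  apply/eqP; rewrite eq_le (spec_partial_sum_le j hv hw hmu e).
  exact: (spec_partial_sum_le j hw hv hx (esym e)).
apply/rowP => i; have := eqs i.+1.
by rewrite !sum_ltnS eqs => /addrI.
Qed.

Lemma spectral_eigvals A : A^t* = A ->
  exists2 v, orthonormal v & A = spec v (eigvals A).
Proof.
move=> hA.
have hermA : A \is hermsymmx.
  by apply/is_hermitianmxP; rewrite expr0 scale1r hA.
have /orthomx_spectralP eA := hermitian_normalmx hermA.
have [s hs] := rearr_perm (map_mx (@complex.Re R) (spectral_diag A)).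
set P := spectralmx A in eA.
have uP : P \is unitarymx by exact: spectral_unitarymx.
pose v i := (row (s i) P)^t*.
have hv : orthonormal v.
  move=> i j; have /unitarymxP/matrixP/(_ (s j) (s i)) := uP.
  rewrite !mxE (inj_eq perm_inj) eq_sym => <-.
  by apply: eq_bigr => l _; rewrite !mxE conjCK mulrC.
exists v => //; apply: spec_of_eigenvectors => // i; rewrite /eigvals hs !mxE.
have -> : (complex.Re (spectral_diag A 0 (s i)))%:C = spectral_diag A 0 (s i).
  have /mxOverP/(_ 0 (s i)) := hermitian_spectral_diag_real hermA.
  exact: RRe_real.
have PA : P *m A = diag_mx (spectral_diag A) *m P.
  by rewrite {1}eA !mulmxA mulmxV ?mul1mx // unitarymx_unit.
have /(congr1 (fun M => M^t*)) : row (s i) (P *m A) =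
    spectral_diag A 0 (s i) *: row (s i) P.
  rewrite PA; apply/rowP => l; rewrite !mxE (bigD1 (s i)) //= big1 => [|m nm].
    by rewrite !mxE eqxx mulr1n addr0.
  by rewrite !mxE eq_sym (negbTE nm) mulr0n mul0r.
rewrite row_mul adjM hA adjZ => ->; congr (_ *: _).
have /mxOverP/(_ 0 (s i)) := hermitian_spectral_diag_real hermA.
exact: CrealP.
Qed.

Lemma eigvals_spec v x : orthonormal v -> nonincreasing x ->
  eigvals (spec v x) = x.
Proof.
move=> hv hx; have [w hw e] := spectral_eigvals (spec_adj v x).
by apply/esym; apply: (spec_inj hv hw hx _ e); exact: rearr_nonincreasing.
Qed.

End Spectral.

(** * Majorization and symmetric convex functions *)

Section SchurConvex.
Variables (R : realType) (d : nat).
Implicit Types x y : 'rV[R]_d.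

(** Let k be the first index where x exceeds y, and j the last earlier index
    where y exceeds x; the latter exists because the partial sum up to k must
    not favour x. Moving mass of y from j to k then brings y closer to x
    without spoiling any partial sum. *)
Lemma transfer_indices x y :
  (forall j : nat, \sum_(i < d | (i < j)%N) x 0 i <=
                   \sum_(i < d | (i < j)%N) y 0 i) ->
  \sum_i x 0 i = \sum_i y 0 i -> x != y ->
  exists j k : 'I_d, [/\ (j < k)%N, x 0 j < y 0 j, y 0 k < x 0 k &
    forall i : 'I_d, (j < i < k)%N -> x 0 i = y 0 i].
Proof.
move=> hle heq nxy.
have [k0 hk0] : exists k, y 0 k < x 0 k.
  apply/existsP; apply: contraNT nxy => /existsPn h.
  have xy i : x 0 i <= y 0 i by rewrite leNgt.
  have /eqP : \sum_i (y 0 i - x 0 i) = 0 by rewrite sumrB heq subrr.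
  rewrite psumr_eq0 => [/allP h0|i _]; last by rewrite subr_ge0.
  apply/eqP/rowP => i; apply/esym/eqP; rewrite -subr_eq0.
  by apply: h0; rewrite mem_index_enum.
case: (@arg_minnP _ k0 (fun k => y 0 k < x 0 k) (fun k => k) hk0) => k hk kmin.
have [j0 hj0] : exists j : 'I_d, (j < k)%N && (x 0 j < y 0 j).
  apply/existsP; apply: contraT => /existsPn h.
  have := hle k.+1; rewrite !sum_ltnS leNgt => /negP[].
  apply: ler_ltD => //; apply: ler_sum => i ik.
  by have := h i; rewrite ik /= -leNgt.
case: (@arg_maxnP _ j0 (fun j : 'I_d => (j < k)%N && (x 0 j < y 0 j))
  (fun k => k) hj0) => j /andP[jk hj] jmax.
exists j, k; split=> // i /andP[ji ik]; apply/eqP; rewrite eq_le !leNgt.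
apply/andP; split; apply/negP => h.
  by have := kmin i h; rewrite leqNgt ik.
by have := jmax i; rewrite ik h => /(_ isT) /=; rewrite /geq /= leqNgt ji.
Qed.

Lemma sum_indicator (P : pred 'I_d) (j : 'I_d) (e : R) :
  \sum_(i | P i) (if i == j then e else 0) = if P j then e else 0.
Proof.
case: ifP => Pj; last first.
  by rewrite big1 // => i Pi; case: eqP => // ij; rewrite -ij Pi in Pj.
by rewrite (bigD1 j) //= eqxx big1 ?addr0 // => i /andP[_ /negbTE->].
Qed.

(** The Hardy-Littlewood-Polya argument. Moving mass e from entry j to entry k
    of y is averaging y with its transpose under (j k), so it does not increase
    phi; with e as large as the smaller of the two discrepancies it makes one
    more entry agree with x. Only x has to be sorted, so that the intermediate
    vectors need not be rearranged. *)
Lemma majorized_convex_le (phi : 'rV[R]_d -> R) :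
  (forall x i j, phi (col_perm (tperm i j) x) = phi x) ->
  (forall x y t, 0 <= t <= 1 ->
     phi (t *: x + (1 - t) *: y) <= t * phi x + (1 - t) * phi y) ->
  forall x y, nonincreasing x ->
  (forall j : nat, \sum_(i < d | (i < j)%N) x 0 i <=
                   \sum_(i < d | (i < j)%N) y 0 i) ->
  \sum_i x 0 i = \sum_i y 0 i -> phi x <= phi y.
Proof.
move=> phi_sym phi_cvx x y hx.
have [n] := ubnP #|[set i | x 0 i != y 0 i]|.
elim: n y => // n IH y; rewrite ltnS => hn hle heq.
have [->//|nxy] := eqVneq x y.
have [j [k [jk hj hk hjk]]] := transfer_indices hle heq nxy.
have nkj : k != j by rewrite -val_eqE /= gtn_eqF.
have njk : (j == k) = false by rewrite eq_sym (negbTE nkj).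
have hkj : x 0 k <= x 0 j by apply: hx; exact: ltnW.
(* The largest transfer from j to k that keeps y above x at j and below x
   at k. *)
pose e := Num.min (y 0 j - x 0 j) (x 0 k - y 0 k).
have e0 : 0 < e by rewrite lt_min !subr_gt0 hj.
have ej : e <= y 0 j - x 0 j by rewrite ge_min lexx.
have ek : e <= x 0 k - y 0 k by rewrite ge_min lexx orbT.
pose y' : 'rV[R]_d :=
  \row_i (y 0 i - (if i == j then e else 0) + (if i == k then e else 0)).
have D0 : 0 < y 0 j - y 0 k by lra.
pose t := e / (y 0 j - y 0 k).
have tE : t * (y 0 j - y 0 k) = e by rewrite /t divfK // gt_eqF.
have y'E : y' = t *: col_perm (tperm j k) y + (1 - t) *: y.
  apply/rowP => i; rewrite !mxE; case: tpermP => [->|->|/eqP ij /eqP ik].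
  - by rewrite eqxx njk -tE; ring.
  - by rewrite eqxx (negbTE nkj) -tE; ring.
  - by rewrite (negbTE ij) (negbTE ik); ring.
have t01 : 0 <= t <= 1.
  by rewrite /t divr_ge0 ?(ltW e0) ?(ltW D0) //= ler_pdivrMr // mul1r; lra.
have phi_le : phi y' <= phi y.
  rewrite y'E (le_trans (phi_cvx _ _ _ t01)) // phi_sym.
  by rewrite -mulrDl addrC subrK mul1r.
have sumE (P : pred 'I_d) : \sum_(i | P i) y' 0 i =
    \sum_(i | P i) y 0 i - (if P j then e else 0) + (if P k then e else 0).
  under eq_bigr => i _ do rewrite mxE.
  by rewrite big_split sumrB /= !sum_indicator.
apply: le_trans phi_le; apply: IH.
- apply: leq_trans hn; apply: proper_card; apply/properP; split.
    apply/subsetP => i; rewrite !inE mxE.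
    have [->|_] := eqVneq i j; first by rewrite (lt_eqF hj).
    have [->|_] := eqVneq i k; first by rewrite (gt_eqF hk).
    by rewrite subr0 addr0.
  have [hjk'|hjk'] := leP (y 0 j - x 0 j) (x 0 k - y 0 k).
    exists j; rewrite !inE ?(lt_eqF hj) // mxE eqxx njk.
    by rewrite /e min_l // addr0 subKr eqxx.
  exists k; rewrite !inE ?(gt_eqF hk) // mxE eqxx (negbTE nkj).
  by rewrite /e min_r ?ltW // subr0 addrC subrK eqxx.
- move=> m; rewrite sumE; have := hle m.
  (* The transfer affects only the partial sums that contain j but not k,
     where y and x agree beyond j. *)
  case: ifP => [jm|jm].
    case: ifP => [_|/negbT]; first by rewrite subrK.
    rewrite -leqNgt => mk _; rewrite addr0 lerBrDr -lerBrDl -sumrB.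
    rewrite (bigID (fun i : 'I_d => (i < j)%N)) /=.
    rewrite [X in _ + X](bigD1 j) ?jm ?ltnn //=.
    rewrite [X in _ + (_ + X)]big1 ?addr0 => [|i /andP[/andP[im]]].
      apply: (le_trans ej); rewrite lerDr.
      rewrite (eq_bigl (fun i : 'I_d => (i < j)%N)) => [|i].
        by have := hle j; rewrite -subr_ge0 -sumrB.
      by case: (ltnP i j) => ij; rewrite ?andbF // (ltn_trans ij jm).
    rewrite -leqNgt => ji ij; rewrite hjk ?subrr // (leq_trans im mk) andbT.
    by rewrite ltn_neqAle ji andbT eq_sym.
  case: ifP => [km|_]; first by rewrite (ltn_trans jk km) in jm.
  by rewrite subr0 addr0.
- by rewrite sumE subrK.
Qed.

End SchurConvex.

(** * Strictly convex unitarily invariant norms *)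

Section Norm.
Variables (R : realType) (d : nat) (N : 'M[R[i]]_d -> R).
Local Notation C := R[i].
Implicit Types (A B D : 'M[C]_d) (v w : 'I_d -> 'cV[C]_d) (x y : 'rV[R]_d).
Hypothesis N_norm : is_norm N.

Lemma normZ (t : R) A : 0 <= t -> N (t%:C *: A) = t * N A.
Proof.
move=> t0; case: N_norm => _ _ -> _; congr (_ * _).
by rewrite /Normc.normc /= expr0n addr0 sqrtr_sqr ger0_norm.
Qed.

Lemma norm_sum (I : finType) (F : I -> 'M[C]_d) :
  N (\sum_i F i) <= \sum_i N (F i).
Proof.
have N0 : N 0 = 0 by rewrite -(scale0r 0) (normZ (t := 0)) // mul0r.
elim/big_ind2: _ => [|A s B t hA hB|//]; first by rewrite N0.
by case: N_norm => _ _ _ tri; apply: le_trans (tri _ _) _; rewrite lerD.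
Qed.

Hypothesis N_ui : unitarily_invariant N.

Lemma norm_conj A U : U \is unitarymx -> N (U *m A *m U^t*) = N A.
Proof. by move=> hU; apply: N_ui; rewrite ?trmxC_unitary. Qed.

Lemma norm_spec_basis v w x : orthonormal v -> orthonormal w ->
  N (spec v x) = N (spec w x).
Proof.
move=> hv hw; pose U : 'M[C]_d := \sum_i tensor (v i) (w i).
have Uw i : U *m w i = v i.
  rewrite mulmx_suml (bigD1 i) //= tensorE hw eqxx scale1r.
  rewrite big1 ?addr0 // => l nl.
  by rewrite tensorE hw eq_sym (negbTE nl) scale0r.
have hU : U \is unitarymx.
  apply/unitarymxP; rewrite {2}/U adj_sum mulmx_sumr.
  rewrite -[RHS](orthonormal_resolution hv); apply: eq_bigr => i _.
  by rewrite tensor_adj mul_tensor Uw.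
rewrite -(norm_conj (spec w x) hU); congr N.
rewrite /spec mulmx_sumr mulmx_suml; apply: eq_bigr => i _.
by rewrite -scalemxAr -scalemxAl mul_tensor tensor_mulr trmxCK Uw.
Qed.

(** In a fixed basis, the norm is a symmetric convex function of the spectrum:
    permuting eigenvalues amounts to permuting the basis vectors. *)
Lemma norm_spec_majorized v w x y : orthonormal v -> orthonormal w ->
  nonincreasing x ->
  (forall j : nat, \sum_(i < d | (i < j)%N) x 0 i <=
                   \sum_(i < d | (i < j)%N) y 0 i) ->
  \sum_i x 0 i = \sum_i y 0 i -> N (spec v x) <= N (spec w y).
Proof.
move=> hv hw hx hle heq; rewrite (norm_spec_basis x hv hw).
apply: (majorized_convex_le (phi := fun z => N (spec w z))) hle heq => //.
  move=> z i j; set s := tperm i j.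
  rewrite -[RHS](@norm_spec_basis (w \o s) w) => [|l m|//]; last first.
    by rewrite /= hw (inj_eq perm_inj).
  congr N; rewrite /spec (reindex_perm s); apply: eq_bigr => l _.
  by rewrite mxE tpermK.
move=> z z' t /andP[t0 t1].
rewrite -!normZ ?subr_ge0 //; case: N_norm => _ _ _ tri.
apply: le_trans (tri _ _); rewrite le_eqVlt; apply/orP; left; apply/eqP.
congr N; rewrite /spec !scaler_sumr -big_split; apply: eq_bigr => l _ /=.
by rewrite !mxE !scalerA -scalerDl rmorphD !rmorphM.
Qed.

Hypothesis N_sc : strictly_convex N.

(** Rescaling to the unit sphere, where strict convexity is assumed. *)
Lemma strict_convex_sphere A B (t : R) :
  N A = N B -> A != B -> 0 < t < 1 ->
  N (t%:C *: A + (1 - t)%:C *: B) < N A.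
Proof.
move=> AB nAB t01; set m := N A; case: (N_norm) => N0 N0E _ _.
have m0 : 0 < m.
  rewrite lt_def N0 andbT; apply: contraNneq nAB => hm.
  by rewrite (N0E A) // (N0E B) // -AB.
have mV : 0 <= m^-1 by rewrite invr_ge0 ltW.
have h1 : N (m^-1%:C *: A) = 1 by rewrite normZ // mulVf // gt_eqF.
have h2 : N (m^-1%:C *: B) = 1 by rewrite normZ // -AB mulVf // gt_eqF.
have mVn : m^-1%:C != 0 :> C.
  by rewrite -(rmorph0 (real_complex R)) (inj_eq (@complexI R)) invr_eq0 gt_eqF.
have h3 : m^-1%:C *: A != m^-1%:C *: B.
  by rewrite (inj_eq (scalerI mVn)).
have := N_sc h1 h2 h3 t01.
rewrite !scalerA ![_ * m^-1%:C]mulrC -!scalerA -scalerDr normZ //.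
by rewrite mulrC ltr_pdivrMr // mul1r.
Qed.

(** The unitary U is the reflection 1 - u u^* with u = p - q, which exchanges
    the unit eigenvectors p and q and hence their eigenvalues. *)
Lemma reflection_swap D (p q : 'cV[C]_d) (c l : R) :
  D^t* = D -> inner p p = 1 -> inner q q = 1 -> inner p q = 0 ->
  D *m p = c%:C *: p -> D *m q = l%:C *: q ->
  exists2 U : 'M[C]_d, U \is unitarymx &
    U *m D *m U^t* = D + (l - c)%:C *: (tensor p p - tensor q q).
Proof.
move=> hD hp hq hpq Dp Dq; pose u := p - q.
have hqp : inner q p = 0 by rewrite inner_conj hpq rmorph0.
have uu : inner u u = 2.
  by rewrite !innerBl !innerBr hp hq hpq hqp; ring.
pose U : 'M[C]_d := 1%:M - tensor u u.
have Uadj : U^t* = U by rewrite adjB tensor_adj trmx1 map_mx1.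
exists U.
  apply/unitarymxP; rewrite Uadj /U mulmxBl mul1mx mulmxBr mulmx1 tensor_mul uu.
  move: (tensor u u) => t; by apply/matrixP => i j; rewrite !mxE; ring.
have Du : D *m u = c%:C *: p - l%:C *: q by rewrite mulmxBr Dp Dq.
have uDu : inner u (D *m u) = (c + l)%:C.
  rewrite Du !innerBl !innerBr !innerZr !conj_real hp hq hpq hqp rmorphD /=.
  by ring.
rewrite Uadj mulmxBl mul1mx !mulmxBr !mulmx1 mulmxBl tensor_mulr hD.
rewrite tensor_mul uDu mul_tensor Du /u !(tensorBl, tensorBr).
rewrite !(tensorZl, tensorZr) !conj_real rmorphD rmorphB /=.
move: (tensor p p) (tensor p q) (tensor q p) (tensor q q) => pp pq qp qq.
by apply/matrixP => i j; rewrite !mxE; ring.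
Qed.

(** Moving an amount s of spectrum from q to p interpolates strictly between D
    and the conjugate of D in which the two eigenvalues are exchanged; both
    have the same norm and they differ. *)
Lemma norm_transfer_lt D (p q : 'cV[C]_d) (c l s : R) :
  D^t* = D -> inner p p = 1 -> inner q q = 1 -> inner p q = 0 ->
  D *m p = c%:C *: p -> D *m q = l%:C *: q -> 0 < s < l - c ->
  N (D + s%:C *: (tensor p p - tensor q q)) < N D.
Proof.
move=> hD hp hq hpq Dp Dq /andP[s0 slc].
have [U hU eU] := reflection_swap hD hp hq hpq Dp Dq.
have lc0 : 0 < l - c by apply: lt_trans slc.
pose t := s / (l - c).
have t01 : 0 < 1 - t < 1.
  by rewrite subr_gt0 ltr_pdivrMr // mul1r slc /= gtrBl divr_gt0.
have neq : D != U *m D *m U^t*.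
  rewrite eU -subr_eq0 opprD addrA subrr add0r oppr_eq0 scaler_eq0.
  rewrite -(rmorph0 (real_complex R)) (inj_eq (@complexI R)) gt_eqF //=.
  apply/eqP => /(congr1 (fun M => inner (M *m p) p)).
  rewrite mulmxBl mul0mx inner0l !tensorE hp hpq scale0r subr0 scale1r hp.
  by move/eqP; rewrite oner_eq0.
have := strict_convex_sphere (esym (norm_conj D hU)) neq t01.
rewrite eU (subKr 1 t); set X := tensor p p - tensor q q.
have -> : (1 - t)%:C *: D + t%:C *: (D + (l - c)%:C *: X) = D + s%:C *: X.
  rewrite scalerDr addrA -scalerDl -rmorphD subrK rmorph1 scale1r scalerA.
  by rewrite -rmorphM /t divfK // gt_eqF.
by [].
Qed.

(** Several transfers out of q are a convex combination of single ones, each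
    moving the total amount. *)
Lemma norm_transfers_lt (I : finType) D (p : I -> 'cV[C]_d) q (c l : R)
    (s : I -> R) :
  D^t* = D -> (forall i, inner (p i) (p i) = 1) -> inner q q = 1 ->
  (forall i, inner (p i) q = 0) -> (forall i, D *m p i = c%:C *: p i) ->
  D *m q = l%:C *: q -> (forall i, 0 <= s i) -> 0 < \sum_i s i < l - c ->
  N (D + \sum_i (s i)%:C *: (tensor (p i) (p i) - tensor q q)) < N D.
Proof.
move=> hD hp hq hpq Dp Dq s0; set s' := \sum_i s i => hs'.
have s'0 : 0 < s' by case/andP: hs'.
pose X i := tensor (p i) (p i) - tensor q q.
have -> : D + \sum_i (s i)%:C *: X i =
    \sum_i (s i / s')%:C *: (D + s'%:C *: X i).
  under [RHS]eq_bigr => i _ do rewrite scalerDr.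
  rewrite big_split /= -scaler_suml -rmorph_sum -mulr_suml mulfV ?gt_eqF //.
  rewrite scale1r; congr (_ + _); apply: eq_bigr => i _.
  by rewrite scalerA -rmorphM divfK // gt_eqF.
apply: le_lt_trans (norm_sum _) _.
under eq_bigr => i _ do rewrite normZ ?divr_ge0 // ?(ltW s'0) //.
have -> : N D = \sum_i (s i / s') * N D.
  by rewrite -mulr_suml -mulr_suml mulfV ?mul1r // gt_eqF.
have lt i : N (D + s'%:C *: X i) < N D.
  by apply: (norm_transfer_lt (c := c) (l := l)).
have [i si] : exists i, 0 < s i.
  apply/existsP; apply: contraLR s'0 => /existsPn h.
  by rewrite -leNgt; apply: sumr_le0 => i _; rewrite leNgt.
rewrite (bigD1 i) //= [ltRHS](bigD1 i) //=; apply: ltr_leD.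
  by rewrite ltr_pM2l // divr_gt0.
by apply: ler_sum => j _; rewrite ler_wpM2l ?divr_ge0 // ltW.
Qed.

End Norm.

(** * Moving a linearly dependent family inside the torus *)

Section Local.
Variables (R : realType) (d k : nat).
Local Notation C := R[i].
Implicit Types (g : 'I_k -> 'cV[C]_d) (q : 'cV[C]_d).

(** A family of k >= d independent vectors would span the space and leave no
    room for q. *)
Lemma dependent_of_orthogonal g q : (d <= k)%N -> q != 0 ->
  (forall i, inner (g i) q = 0) ->
  exists2 al : 'I_k -> C, exists i, al i != 0 & \sum_i al i *: g i = 0.
Proof.
move=> dk q0 gq; pose M : 'M[C]_(k, d) := \matrix_(i, l) g i l 0.
have Mq : M *m map_mx Num.conj q = 0.
  apply/colP => i; rewrite !mxE -[RHS](gq i); apply: eq_bigr => l _.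
  by rewrite !mxE.
have : kermx M != 0.
  rewrite kermx_eq0; apply: contraNN q0 => Mfree.
  have Mfull : row_full M.
    rewrite /row_full eqn_leq rank_leq_col /=.
    by move: Mfree; rewrite /row_free => /eqP ->.
  have := row_full_inj Mfull; rewrite -(mulmx0 _ M) in Mq => /(_ _ _ _ Mq).
  move/matrixP => h; apply/eqP/colP => i; have := h i 0.
  by rewrite !mxE => /eqP; rewrite conjC_eq0 => /eqP.
case/rowV0Pn => v /sub_kermxP vM v0.
exists (fun i => v 0 i).
  apply/existsP; apply: contraR v0 => /existsPn h.
  by apply/eqP/rowP => i; rewrite mxE; apply/eqP; rewrite -[_ == _]negbK h.
apply/colP => l; move/matrixP/(_ 0 l): vM; rewrite summxE !mxE => vM.
by rewrite -[RHS]vM; apply: eq_bigr => i _; rewrite !mxE.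
Qed.

(** When a vector g with squared norm a is replaced by c g + s q, the cross term
    of its rank-one operator is governed by c s^*. Prescribing this product to
    be z leads to a quadratic equation for c^2, solvable with c near 1 as soon
    as z is small; the last two bounds say that the move is of the size of z. *)
Lemma rotation_coefficients (a : R) (z : C) : 0 < a -> 4 * normc z ^+ 2 <= a ->
  exists (c : R) (s : C), [/\ c%:C * (s^*)%R = z,
    c ^+ 2 * a + normc s ^+ 2 = a, normc s ^+ 2 <= 2 * normc z ^+ 2 &
    (c - 1) ^+ 2 * a + normc s ^+ 2 <= 4 * normc z ^+ 2].
Proof.
move=> a0 hz; set m := normc z ^+ 2 in hz *.
have m0 : 0 <= m by exact: sqr_ge0.
have D0 : 0 <= 1 - 4 * m / a by rewrite subr_ge0 ler_pdivrMr // mul1r.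
pose r := Num.sqrt (1 - 4 * m / a).
have r0 : 0 <= r by exact: sqrtr_ge0.
have r2 : r ^+ 2 * a = a - 4 * m.
  by rewrite sqr_sqrtr // mulrBl divfK ?gt_eqF // mul1r.
have r1 : r <= 1.
  rewrite -(@ler_pXn2r _ 2) ?nnegrE // expr1n -(ler_pM2r a0) r2 mul1r; lra.
pose c := Num.sqrt ((1 + r) / 2).
have h0 : 0 < (1 + r) / 2 by lra.
have c0 : 0 < c by rewrite sqrtr_gt0.
have c2 : c ^+ 2 = (1 + r) / 2 by rewrite sqr_sqrtr // ltW.
have c1 : c <= 1.
  by rewrite -(@ler_pXn2r _ 2) ?nnegrE ?(ltW c0) // expr1n c2; lra.
have cV : normc (c^-1)%:C = c^-1.
  by rewrite /Normc.normc /= expr0n addr0 sqrtr_sqr ger0_norm // invr_ge0 ltW.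
have nconj : normc (z^*)%R = normc z.
  by apply: complexI; change (`|(z^*)%R| = `|z|); rewrite norm_conjC.
pose s : C := (c^-1)%:C * (z^*)%R.
have sE : normc s ^+ 2 = a * (1 - r) / 2.
  rewrite /s Normc.normcM cV nconj exprMn -/m exprVn c2.
  apply: (mulfI (x := (1 + r) / 2)); first by rewrite gt_eqF.
  rewrite mulrA mulfV ?gt_eqF // mul1r.
  have -> : (1 + r) / 2 * (a * (1 - r) / 2) = (a - r ^+ 2 * a) / 4 by field.
  by rewrite r2; field.
have sm : normc s ^+ 2 <= 2 * m.
  have -> : m = (a - r ^+ 2 * a) / 4 by rewrite r2; field.
  rewrite sE; have : 0 <= a * (1 - r) * r.
    by rewrite !mulr_ge0 ?subr_ge0 // ltW.
  by move=> h; nra.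
exists c, s; split=> //.
- rewrite /s rmorphM /= conj_real conjCK mulrA -rmorphM mulfV ?gt_eqF //.
  by rewrite mul1r.
- by rewrite c2 sE; field.
have : (c - 1) ^+ 2 * a <= normc s ^+ 2; last lra.
have -> : normc s ^+ 2 = (1 - c ^+ 2) * a by rewrite sE c2; field.
by rewrite ler_wpM2r ?(ltW a0) //; nra.
Qed.

End Local.

(** * Water filling *)

Section WaterFilling.
Variables (R : realType) (d : nat).
Implicit Types (lam mu b : 'rV[R]_d).

Lemma nonincreasing_threshold lam (c : R) : nonincreasing lam ->
  exists p : nat, forall i : 'I_d, (i < p)%N = (c < lam 0 i).
Proof.
move=> hlam; pose P n := [forall i : 'I_d, (n <= i)%N ==> (lam 0 i <= c)].
have exP : exists n, P n.
  by exists d; apply/forallP => i; apply/implyP; rewrite leqNgt ltn_ord.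
case: (ex_minnP exP) => p /forallP hp pmin; exists p => i.
case: ltnP => ip; last by have := hp i; rewrite ip /= ltNge => ->.
apply/esym; rewrite ltNge; apply/negP => hi.
have : P i.
  apply/forallP => l; apply/implyP => il; exact: le_trans (hlam _ _ il) hi.
by move/pmin; rewrite leqNgt ip.
Qed.

(** The spectrum that water filling of level c removes from lam; the residual
    lam - excess lam c is the entrywise minimum of lam and c. *)
Definition excess lam (c : R) : 'rV[R]_d := \row_i Num.max (lam 0 i - c) 0.

Lemma residual_nonincreasing lam c : nonincreasing lam ->
  nonincreasing (lam - excess lam c).
Proof.
move=> hlam i j ij; rewrite !mxE; have := hlam i j ij.
by case: (leP (lam 0 i - c) 0); case: (leP (lam 0 j - c) 0) => *; lra.
Qed.

(** Here b is a diagonal dominated by lam and mu the spectrum it comes from.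
    Beyond the threshold p of lam the residual is lam itself, which dominates
    the tail of b, so equality of the totals yields the inequality for the
    heads. Before p the residual is constant: either all of the first j entries
    of mu are at least c, or all later ones are below c, and in that case
    dropping them from the inequality at p only helps. *)
Lemma water_filling lam mu b c :
  nonincreasing lam -> nonincreasing mu ->
  (forall i, b 0 i <= lam 0 i) ->
  \sum_i b 0 i = \sum_i (lam - excess lam c) 0 i ->
  (forall j : nat, \sum_(i < d | (i < j)%N) b 0 i <=
                   \sum_(i < d | (i < j)%N) mu 0 i) ->
  forall j : nat, \sum_(i < d | (i < j)%N) (lam - excess lam c) 0 i <=
                  \sum_(i < d | (i < j)%N) mu 0 i.
Proof.
move=> hlam hmu hb eqb hle; set x := lam - excess lam c in eqb *.
have [p hp] := nonincreasing_threshold c hlam.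
have x_le (i : 'I_d) : (p <= i)%N -> x 0 i = lam 0 i.
  rewrite leqNgt hp -leNgt => h; rewrite !mxE max_r ?subr_le0 //; lra.
have x_gt (i : 'I_d) : (i < p)%N -> x 0 i = c.
  rewrite hp => h; rewrite !mxE max_l ?subr_ge0 ?ltW //; lra.
have large j : (p <= j)%N -> \sum_(i < d | (i < j)%N) x 0 i <=
    \sum_(i < d | (i < j)%N) mu 0 i.
  move=> pj; apply: le_trans (hle j).
  move: eqb; rewrite (bigID (fun i : 'I_d => (i < j)%N)) /=.
  rewrite [RHS](bigID (fun i : 'I_d => (i < j)%N)) /= => eqb.
  suff : \sum_(i < d | ~~ (i < j)%N) b 0 i <= \sum_(i < d | ~~ (i < j)%N) x 0 i.
    by lra.
  by apply: ler_sum => i; rewrite -leqNgt => ji; rewrite x_le ?(leq_trans pj).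
move=> j; have [/large //|jp] := leqP p j.
have [m hm] := nonincreasing_cut j hmu.
rewrite -subr_ge0 -sumrB.
rewrite (eq_bigr (fun i : 'I_d => mu 0 i - c)) => [|i ij]; last first.
  by rewrite x_gt // (ltn_trans ij jp).
have [cm|mc] := leP c m.
  apply: sumr_ge0 => i ij; have := hm i; rewrite ij; lra.
have : 0 <= \sum_(i < d | (i < p)%N) (mu 0 i - c).
  apply: le_trans (_ : 0 <= \sum_(i < d | (i < p)%N) (mu 0 i - x 0 i)) _.
    by rewrite sumrB subr_ge0; exact: large.
  by apply: ler_sum => i ip; rewrite x_gt.
rewrite (bigID (fun i : 'I_d => (i < j)%N)) /= => h.
have tail : \sum_(i < d | (i < p)%N && ~~ (i < j)%N) (mu 0 i - c) <= 0.
  apply: sumr_le0 => i /andP[_ /negbTE ij]; have := hm i; rewrite ij; lra.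
have head : \sum_(i < d | (i < p)%N && (i < j)%N) (mu 0 i - c) =
    \sum_(i < d | (i < j)%N) (mu 0 i - c).
  apply: eq_bigl => i; case: (ltnP i j) => ij; rewrite ?andbF // andbT.
  by rewrite (ltn_trans ij jp).
by rewrite -head; lra.
Qed.

End WaterFilling.

(** * Frame operators and descent directions *)

Section Frame.
Variables (R : realType) (d k : nat).
Local Notation C := R[i].
Implicit Types (S D : 'M[C]_d) (G : 'I_k -> 'cV[C]_d) (x q : 'cV[C]_d)
  (a : 'rV[R]_k).

Lemma vnorm_eq x (r : R) : inner x x = r%:C -> vnorm x ^+ 2 = r.
Proof. by rewrite -vnorm_sqr => /complexI. Qed.

Lemma torus_inner a G i : torus a G -> inner (G i) (G i) = (a 0 i)%:C.
Proof. by move=> hG; rewrite -vnorm_sqr hG. Qed.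

Lemma frame_op_form G x :
  inner (frame_op G *m x) x = (\sum_i normc (inner x (G i)) ^+ 2)%:C.
Proof.
rewrite frame_op_psd rmorph_sum; apply: eq_bigr => i _.
by rewrite rmorphXn.
Qed.

Lemma frame_op_ker G q i : frame_op G *m q = 0 -> inner (G i) q = 0.
Proof.
move=> hq; have := frame_op_psd G q; rewrite hq inner0l => /esym/eqP.
rewrite psumr_eq0 => [/allP/(_ i)|j _]; last by rewrite exprn_ge0.
rewrite mem_index_enum => /(_ isT); rewrite /= sqrf_eq0 normr_eq0 => /eqP h.
by rewrite inner_conj h rmorph0.
Qed.

(** The trace of a frame operator depends on the norms of the vectors only,
    so that all points of a torus share it. *)
Lemma frame_op_trace a G (v : 'I_d -> 'cV[C]_d) : torus a G -> orthonormal v ->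
  \sum_i inner (frame_op G *m v i) (v i) = (\sum_j a 0 j)%:C.
Proof.
move=> hG hv; under eq_bigr => i _ do rewrite frame_op_form.
rewrite -rmorph_sum exchange_big /= !rmorph_sum; apply: eq_bigr => j _ /=.
rewrite -(torus_inner j hG) (parseval _ hv); congr _%:C.
by apply: eq_bigr => i _; rewrite normc_innerC.
Qed.

Lemma inner_real_comb (c : R) (s : C) x q : inner x q = 0 -> inner q q = 1 ->
  inner (c%:C *: x + s *: q) (c%:C *: x + s *: q) =
  (c ^+ 2)%:C * inner x x + (normc s ^+ 2)%:C.
Proof.
move=> hxq hq; have hqx : inner q x = 0 by rewrite inner_conj hxq rmorph0.
rewrite !innerDl !innerDr !innerZl !innerZr hxq hqx hq conj_real.
rewrite [in RHS]rmorphXn.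
rewrite [(normc s ^+ 2)%:C]rmorphXn /= [(normc s)%:C ^+ 2]normCK.
by ring.
Qed.

(** With p the normalization of x, the rotation towards q moves the mass |s|^2
    from p to q; what remains is linear in z x. *)
Lemma rotated_tensor (a c : R) (s z : C) x q : 0 < a ->
  c%:C * (s^*)%R = z -> c ^+ 2 * a + normc s ^+ 2 = a ->
  tensor (c%:C *: x + s *: q) (c%:C *: x + s *: q) =
  tensor x x - (normc s ^+ 2)%:C *:
    (tensor ((Num.sqrt a)^-1%:C *: x) ((Num.sqrt a)^-1%:C *: x) - tensor q q)
  + (tensor (z *: x) q + tensor q (z *: x)).
Proof.
move=> a0 hz hca.
have e1 : c%:C * c%:C + (normc s ^+ 2)%:C *
    ((Num.sqrt a)^-1%:C * (Num.sqrt a)^-1%:C) = 1 :> C.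
  rewrite -!rmorphM -rmorphD -expr2 -[_ * (Num.sqrt a)^-1]expr2 exprVn.
  rewrite sqr_sqrtr ?ltW // (_ : _ + _ = 1) ?rmorph1 //.
  apply: (mulIf (x := a)); first by rewrite gt_eqF.
  by rewrite mulrDl divfK ?gt_eqF // mul1r.
have e2 : s * (s^*)%R = (normc s ^+ 2)%:C by rewrite rmorphXn /= [RHS]normCK.
have e3 : s * c%:C = (z^*)%R by rewrite -hz rmorphM /= conj_real conjCK mulrC.
rewrite !tensorDl !tensorDr !tensorZl !tensorZr !conj_real !scalerA.
rewrite hz e2 e3.
have -> : c%:C * c%:C = 1 - (normc s ^+ 2)%:C *
  ((Num.sqrt a)^-1%:C * (Num.sqrt a)^-1%:C) by rewrite -e1 addrK.
move: (tensor x x) (tensor x q) (tensor q x) (tensor q q) => xx xq qx qq.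
by apply/matrixP => i j; rewrite !mxE; ring.
Qed.

(** If the kernel of the frame operator contains an eigenvector q of S for
    l > c1, each g_i can be rotated slightly towards q. Choosing the cross terms
    proportional to a linear relation between the g_i makes them cancel exactly,
    so that the residual changes only by transfers of spectrum from q, where
    it is l, to the normalized g_i, where it is c1. Transfers of less
    than l - c1 in total strictly decrease the norm. *)
Lemma local_descent (N : 'M[C]_d -> R) S a G0 q (c1 l e : R) :
  is_norm N -> unitarily_invariant N -> strictly_convex N ->
  S^t* = S -> (forall i, 0 < a 0 i) -> (d <= k)%N -> torus a G0 ->
  (forall i, (S - frame_op G0) *m G0 i = c1%:C *: G0 i) ->
  inner q q = 1 -> frame_op G0 *m q = 0 -> S *m q = l%:C *: q -> c1 < l ->
  0 < e ->
  exists G, [/\ torus a G, fam_dist G0 G < e & Theta N S G < Theta N S G0].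
Proof.
move=> hN hU hC hS a0 dk hG0 hc1 hq Kq Sq c1l e0.
have gq i : inner (G0 i) q = 0 by exact: frame_op_ker.
have q0 : q != 0 by rewrite -inner_eq0 hq oner_eq0.
have [al [i0 ali0] hal] := dependent_of_orthogonal dk q0 gq.
pose K := \sum_i normc (al i) ^+ 2.
have al_le i : normc (al i) ^+ 2 <= K.
  rewrite /K (bigD1 i) //= lerDl; apply: sumr_ge0 => j _; exact: sqr_ge0.
have al_gt0 : 0 < normc (al i0) ^+ 2.
  rewrite exprn_even_gt0 //=; apply: contra ali0 => /eqP h.
  by apply/eqP; exact: Normc.eq0_normc.
have K0 : 0 < K by apply: lt_le_trans (al_le i0).
(* Below m the coefficients of every rotation exist, the mass moved stays
   below the gap l - c1, and the family stays within distance e. *)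
pose m := \big[Num.min/Num.min (l - c1) (e ^+ 2)]_i a 0 i.
have m0 : 0 < m.
  by apply: lt_bigmin => [|i _]; rewrite ?lt_min ?subr_gt0 ?c1l ?exprn_gt0.
have ma i : m <= a 0 i by exact: bigmin_le.
have [ml me] : m <= l - c1 /\ m <= e ^+ 2.
  by apply/andP; rewrite -le_min; exact: bigmin_le_id.
pose t := Num.sqrt (m / (8 * K)).
have t0 : 0 < t by rewrite sqrtr_gt0 divr_gt0 // mulr_gt0.
have t2 : t ^+ 2 * K = m / 8.
  rewrite sqr_sqrtr; last by rewrite divr_ge0 ?mulr_ge0 // ltW.
  by field; rewrite gt_eqF.
have tC (z : C) : normc (t%:C * z) ^+ 2 = t ^+ 2 * normc z ^+ 2.
  rewrite Normc.normcM exprMn; congr (_ ^+ 2 * _).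
  by rewrite /Normc.normc /= expr0n addr0 sqrtr_sqr ger0_norm // ltW.
have z_le i : normc (t%:C * al i) ^+ 2 <= m / 8.
  by rewrite tC -t2 ler_wpM2l ?sqr_ge0.
have /fin_all_exists [cs hcs] i : exists cs : R * C,
    [/\ cs.1%:C * (cs.2^*)%R = t%:C * al i,
      cs.1 ^+ 2 * a 0 i + normc cs.2 ^+ 2 = a 0 i,
      normc cs.2 ^+ 2 <= 2 * normc (t%:C * al i) ^+ 2 &
      (cs.1 - 1) ^+ 2 * a 0 i + normc cs.2 ^+ 2 <=
        4 * normc (t%:C * al i) ^+ 2].
  have [|c [s h]] := @rotation_coefficients R (a 0 i) (t%:C * al i) (a0 i).
    by have := z_le i; have := ma i; lra.
  by exists (c, s).
pose G i := (cs i).1%:C *: G0 i + (cs i).2 *: q.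
exists G; split.
- move=> i; apply: vnorm_eq; have [_ h _ _] := hcs i.
  by rewrite inner_real_comb // (torus_inner i hG0) -rmorphM -rmorphD h.
- apply: bigmax_lt => // i _.
  rewrite -(@ltr_pXn2r _ 2) ?nnegrE ?vnorm_ge0 ?ltW //.
  have [_ _ _ h] := hcs i.
  have -> : vnorm (G0 i - G i) ^+ 2 =
      ((cs i).1 - 1) ^+ 2 * a 0 i + normc (cs i).2 ^+ 2.
    apply: vnorm_eq.
    have -> : G0 i - G i = - (((cs i).1 - 1)%:C *: G0 i + (cs i).2 *: q).
      by rewrite /G rmorphB rmorph1 scalerBl scale1r [in RHS]addrAC opprB.
    rewrite -scaleN1r innerZl innerZr rmorphN rmorph1 mulrA mulrNN !mulr1 mul1r.
    by rewrite inner_real_comb // (torus_inner i hG0) -rmorphM -rmorphD.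
  by have := z_le i; lra.
pose r i := (Num.sqrt (a 0 i))^-1%:C *: G0 i.
have -> : Theta N S G = N (S - frame_op G0 +
    \sum_i (normc (cs i).2 ^+ 2)%:C *: (tensor (r i) (r i) - tensor q q)).
  rewrite /Theta; congr N; rewrite -addrA; congr (_ + _).
  (* Summing rotated_tensor over i, the sum s1 of all cross terms is the image
     of the linear relation between the g_i, hence zero. *)
  rewrite -[X in _ + X]opprK -opprD; congr (- _).
  under [LHS]eq_bigr => i _.
    have [h1 h2 _ _] := hcs i.
    rewrite (rotated_tensor _ _ (a0 i) h1 h2); over.
  rewrite big_split sumrB /=; set s1 := \sum_(i < k) (_ + _).
  suff -> : s1 = 0 by rewrite addr0.
  have h0 : \sum_i (t%:C * al i) *: G0 i = 0.
    under eq_bigr => i _ do rewrite -scalerA.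
    by rewrite -scaler_sumr hal scaler0.
  have s1E : s1 = tensor (\sum_i (t%:C * al i) *: G0 i) q +
      tensor q (\sum_i (t%:C * al i) *: G0 i).
    rewrite /s1 big_split /=; congr (_ + _).
      by rewrite /tensor mulmx_suml.
    rewrite -[RHS]tensor_adj /tensor mulmx_suml adj_sum.
    by apply: eq_bigr => i _; rewrite -/(tensor _ _) tensor_adj.
  by rewrite s1E h0 /tensor mul0mx trmx0 map_mx0 mulmx0 addr0.
have sa i : (Num.sqrt (a 0 i))^-1 ^+ 2 * a 0 i = 1.
  by rewrite exprVn sqr_sqrtr ?ltW // mulVf // gt_eqF.
apply: (norm_transfers_lt hN hU hC (c := c1) (l := l)) => //.
- by rewrite adjB hS frame_op_adj.
- move=> i; rewrite innerZl innerZr conj_real (torus_inner i hG0) -!rmorphM.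
  by rewrite mulrA -expr2 sa.
- by move=> i; rewrite innerZl gq mulr0.
- by move=> i; rewrite /r -scalemxAr hc1 !scalerA mulrC.
- by rewrite mulmxBl Kq subr0.
- by move=> i; exact: sqr_ge0.
apply/andP; split.
  have s0 : 0 < normc (cs i0).2 ^+ 2.
    rewrite exprn_even_gt0 //=; apply/eqP => h.
    have [hz _ _ _] := hcs i0.
    have s00 : (cs i0).2 = 0 by exact: Normc.eq0_normc.
    have := tC (al i0); rewrite -hz s00 rmorph0 mulr0 Normc.normc0 expr0n /=.
    by move/eqP; rewrite eq_sym mulf_eq0 !gt_eqF // exprn_gt0.
  rewrite (bigD1 i0) //=; apply: ltr_wpDr => //.
  by apply: sumr_ge0 => i _; exact: sqr_ge0.
apply: le_lt_trans (_ : 2 * (t ^+ 2 * K) < _); last by rewrite t2; lra.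
rewrite /K !mulr_sumr; apply: ler_sum => i _.
by rewrite -tC; have [_ _ h _] := hcs i.
Qed.

End Frame.

(** * Structure and optimality of the local minimizer *)

Section Main.
Variables (R : realType) (d k : nat).
Local Notation C := R[i].
Implicit Types (S : 'M[C]_d) (G : 'I_k -> 'cV[C]_d) (x q : 'cV[C]_d)
  (a : 'rV[R]_k) (lam : 'rV[R]_d).

Lemma unit_multiple (z : 'cV[C]_d) : z != 0 ->
  exists c : R, inner (c%:C *: z) (c%:C *: z) = 1.
Proof.
move=> z0; have hz : 0 < vnorm z.
  rewrite lt_def vnorm_ge0 andbT; apply: contra z0 => /eqP h.
  by rewrite -inner_eq0 -vnorm_sqr h expr0n.
exists (vnorm z)^-1.
rewrite innerZl innerZr conj_real -vnorm_sqr -!rmorphM mulrA -expr2.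
by rewrite exprVn mulVf ?rmorph1 // expf_neq0 // gt_eqF.
Qed.

(** The hypothesis on the g_i says (S - F) F = c1 F for the frame operator F;
    taking adjoints, F commutes with S. For an eigenvector x of S, the vector
    y = F x then satisfies F y = (l - c1) y. If l <= c1, positivity of F forces
    y = 0. Otherwise z = y - (l - c1) x lies in the kernel of F and is an
    eigenvector of S for l > c1, which local minimality forbids unless z = 0. *)
Lemma frame_op_eigen (N : 'M[C]_d -> R) S a G0 (c1 l : R) x :
  psd S -> (forall i, 0 < a 0 i) -> (d <= k)%N ->
  is_norm N -> unitarily_invariant N -> strictly_convex N ->
  local_minimizer (Theta N S) a G0 ->
  (forall i, (S - frame_op G0) *m G0 i = c1%:C *: G0 i) ->
  S *m x = l%:C *: x -> frame_op G0 *m x = (Num.max (l - c1) 0)%:C *: x.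
Proof.
move=> hS a0 dk hN hU hC [hG0 [e e0 hmin]] hc1 Sx.
have hSa := psd_adj hS.
set F := frame_op G0 in hc1 *.
have Fadj : F^t* = F by exact: frame_op_adj.
have DF : (S - F) *m F = c1%:C *: F.
  rewrite {2 3}/F /frame_op mulmx_sumr scaler_sumr; apply: eq_bigr => i _.
  by rewrite mul_tensor hc1 tensorZl.
have SF : S *m F = F *m S.
  have := congr1 (fun M => M^t*) DF.
  rewrite /= adjM adjZ conj_real adjB hSa Fadj -DF mulmxBl mulmxBr.
  by move/addIr.
pose y := F *m x.
have Sy : S *m y = l%:C *: y by rewrite /y mulmxA SF -mulmxA Sx -scalemxAr.
have Fy : F *m y = (l - c1)%:C *: y.
  have := congr1 (fun M => M *m x) DF.
  rewrite /= -scalemxAl -mulmxA -/y mulmxBl Sy => h.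
  by rewrite rmorphB scalerBl -h opprB addrC subrK.
have [lc|lc] := leP (l - c1) 0.
  have yy : inner y y =
      ((l - c1) * \sum_i normc (inner x (G0 i)) ^+ 2)%:C.
    rewrite rmorphM /= -frame_op_form -/F -/y -innerZl -Fy inner_adj Fadj.
    by [].
  rewrite rmorph0 scale0r; apply/eqP; rewrite -inner_eq0 eq_le inner_ge0 andbT.
  rewrite -/y yy -(rmorph0 (real_complex R)) lecR mulr_le0_ge0 //.
  by apply: sumr_ge0 => i _; exact: sqr_ge0.
pose z := y - (l - c1)%:C *: x.
have Fz : F *m z = 0 by rewrite mulmxBr Fy -scalemxAr subrr.
have Sz : S *m z = l%:C *: z.
  by rewrite mulmxBr Sy -scalemxAr Sx scalerBr !scalerA mulrC.
have [/subr0_eq//|/unit_multiple [c hq]] := eqVneq z 0.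
set q := c%:C *: z in hq.
have Fq : F *m q = 0 by rewrite -scalemxAr Fz scaler0.
have Sq : S *m q = l%:C *: q by rewrite -scalemxAr Sz !scalerA mulrC.
have c1l : c1 < l by rewrite -subr_gt0.
have [G [hG hd]] :=
  local_descent hN hU hC hSa a0 dk hG0 hc1 hq Fq Sq c1l e0.
by rewrite ltNge hmin.
Qed.

(** In the eigenbasis of S, the diagonal of S - frame_op G is at most lam and
    has the same trace as the water-filling residual; Ky Fan's principle
    bounds it by the eigenvalues of S - frame_op G. *)
Lemma residual_majorized S a G (v : 'I_d -> 'cV[C]_d) lam (c : R) :
  orthonormal v -> nonincreasing lam -> S = spec v lam -> torus a G ->
  \sum_j a 0 j = \sum_i excess lam c 0 i ->
  (forall j : nat, \sum_(i < d | (i < j)%N) (lam - excess lam c) 0 i <=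
     \sum_(i < d | (i < j)%N) eigvals (S - frame_op G) 0 i) /\
  \sum_i (lam - excess lam c) 0 i = \sum_i eigvals (S - frame_op G) 0 i.
Proof.
move=> hv hlam hSv hG ha; set E := S - frame_op G.
have Eadj : E^t* = E by rewrite /E adjB frame_op_adj hSv spec_adj.
have [w hw eE] := spectral_eigvals Eadj.
set mu := eigvals E in eE *.
have hmu : nonincreasing mu by exact: rearr_nonincreasing.
pose b : 'rV[R]_d :=
  \row_i (lam 0 i - \sum_j normc (inner (v i) (G j)) ^+ 2).
have bE i : inner (E *m v i) (v i) = (b 0 i)%:C.
  rewrite /E mulmxBl innerBl frame_op_form mxE rmorphB; congr (_ - _).
  by rewrite hSv spec_eigen // innerZl hv eqxx mulr1.
have sum_b : \sum_i b 0 i = \sum_i mu 0 i.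
  apply: complexI; rewrite -(trace_form mu hv hw) -eE rmorph_sum.
  by apply: eq_bigr => i _; rewrite bE.
have sum_x : \sum_i b 0 i = \sum_i (lam - excess lam c) 0 i.
  apply: complexI; rewrite rmorph_sum /=.
  under eq_bigr => i _ do rewrite -bE /E mulmxBl innerBl.
  rewrite sumrB (frame_op_trace hG hv) ha hSv (spec_diag_sum _ predT hv).
  by rewrite -rmorphB -sumrB; congr _%:C; apply: eq_bigr => i _; rewrite !mxE.
split; last by rewrite -sum_x.
apply: (water_filling hlam hmu _ sum_x) => [i|j].
  by rewrite mxE gerBl; apply: sumr_ge0 => j _; exact: sqr_ge0.
have := ky_fan j hv hw hmu; rewrite -eE.
by under eq_bigr => i _ do rewrite bE; rewrite -rmorph_sum lecR.
Qed.

End Main.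

Theorem theorem4p10 (R : realType) (d k : nat) (S : 'M[R[i]]_d) (a : 'rV[R]_k)
    (N : 'M[R[i]]_d -> R) (G0 : 'I_k -> 'cV[R[i]]_d) (c1 : R) :
  psd S ->
  (forall i, 0 < a 0 i) ->
  nonincreasing a ->
  (d <= k)%N ->
  is_norm N ->
  unitarily_invariant N ->
  strictly_convex N ->
  local_minimizer (Theta N S) a G0 ->
  (forall i, (S - frame_op G0) *m G0 i = c1%:C *: G0 i) ->
  [/\ nonincreasing (eigvals S) /\ (forall i, 0 <= eigvals S 0 i),
      exists2 v : 'I_d -> 'cV[R[i]]_d, orthonormal_basis v &
        S = \sum_(i < d) (eigvals S 0 i)%:C *: tensor (v i) (v i) /\
        frame_op G0 =
          \sum_(i < d)
            (Num.max (eigvals S 0 i - c1) 0)%:C *: tensor (v i) (v i),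
      forall G : 'I_k -> 'cV[R[i]]_d, torus a G ->
        majorized (eigvals (S - frame_op G0)) (eigvals (S - frame_op G)) &
      global_minimizer (Theta N S) a G0].
Proof.
move=> hS a0 _ dk hN hU hC hmin hc1.
have [v hv eS] := spectral_eigvals (psd_adj hS).
set lam := eigvals S in eS *.
have hlam : nonincreasing lam by exact: rearr_nonincreasing.
have eF : frame_op G0 = spec v (excess lam c1).
  apply: spec_of_eigenvectors => // i; rewrite mxE.
  apply: (frame_op_eigen hS a0 dk hN hU hC hmin hc1).
  by rewrite {1}eS spec_eigen.
have hG0 : torus a G0 by case: hmin.
have eD : S - frame_op G0 = spec v (lam - excess lam c1).
  rewrite {1}eS eF /spec -sumrB; apply: eq_bigr => i _.
  by rewrite -scalerBl -rmorphB !mxE.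
have hx := residual_nonincreasing c1 hlam.
have hsum : \sum_j a 0 j = \sum_i excess lam c1 0 i.
  apply: complexI; rewrite -(frame_op_trace hG0 hv) eF.
  exact: (spec_diag_sum _ predT hv).
have maj G (hG : torus a G) := residual_majorized hv hlam eS hG hsum.
split.
- split=> // i; have := hS (v i).
  by rewrite eS spec_eigen // innerZl hv eqxx mulr1 ler0c.
- exists v; first exact: orthonormal_is_basis.
  split=> //; rewrite eF; apply: eq_bigr => i _.
  by rewrite mxE.
- move=> G hG; have [h1 h2] := maj G hG.
  rewrite eD (eigvals_spec hv hx) /majorized (rearr_id hx).
  by rewrite rearr_id //; exact: rearr_nonincreasing.
- split=> // G hG; have [h1 h2] := maj G hG.
  have Eadj : (S - frame_op G)^t* = S - frame_op G.
    by rewrite adjB frame_op_adj (psd_adj hS).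
  have [w hw eE] := spectral_eigvals Eadj.
  rewrite /Theta eD [in leRHS]eE.
  exact: (norm_spec_majorized hN hU hv hw hx h1 h2).
Qed.
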